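(* For every integer $a\ge 0$, $\overline{T_a}=\mathbb{R}_{\ge 0}$ (closure in the Euclidean topology on $\mathbb{R}$). Moreover, $T_0=\mathbb{Q}_{>0}$.
   Context: Partitions are drawn as Young diagrams $\mathbb{D}(\lambda)$ in English notation; $c_{i,j}$ is the cell in row $i$, column $j$. The hook length $h_\lambda(c)$ is the number of cells of $\mathbb{D}(\lambda)$ weakly right of $c$ in its row or weakly below $c$ in its column (counting $c$ once). For $\mu\subseteq\lambda$, an excited diagram of $\lambda/\mu$ is a subset of $\mathbb{D}(\lambda)$ obtained from $\mathbb{D}(\mu)$ by repeatedly replacing a cell $c_{i,j}\in D$ by $c_{i+1,j+1}$, allowed iff $c_{i+1,j+1}\in\mathbb{D}(\lambda)$ and none of $c_{i,j+1},c_{i+1,j},c_{i+1,j+1}$ lies in $D$; $\mathbb{E}(\lambda/\mu)$ is their set. A ribbon with $n$ cells is read from its lower-left to its upper-right cell, each successive cell directly right of or directly above the previous; it corresponds to the set of $i\in\{1,\ldots,n-1\}$ with cell $i$ directly below cell $i+1$. A descent set is a non-empty finite set $I$ of positive integers; $\lambda^I$ is the unique partition with $\lambda^I_1=\lambda^I_2$ such that the cells $c_{i,j}\in\mathbb{D}(\lambda^I)$ with fewer than three of $c_{i,j+1},c_{i+1,j},c_{i+1,j+1}$ in $\mathbb{D}(\lambda^I)$ form a ribbon corresponding to $I$; this ribbon is $\mathbb{D}(\lambda^I)\setminus\mathbb{D}(\mu^I)$ for a partition $\mu^I$. Let $s(I)=\lambda^I_1-1$. Naruse-Newton coefficients: every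 excited diagram of $\lambda^I/\mu^I$ meets row 1 in $\{c_{1,1},\ldots,c_{1,r}\}$, $0\le r\le s$; for $0\le j\le s(I)$, $C_j(I)=\sum_D\prod_{c\in D,\,c\notin\text{row }1}h_{\lambda^I}(c)$, summed over $D\in\mathbb{E}(\lambda^I/\mu^I)$ with exactly $s-j$ cells in row 1. For an integer $a\ge0$, $T_a=\{C_{s-a-1}(I)/C_{s-a}(I)\mid I\text{ a descent set with } s=s(I)\ge a+1\}$. *)

(* Defs.v *)
From HB Require Import structures.
From mathcomp Require Import all_boot all_order all_algebra fingraph.
From mathcomp Require Import finmap.
From mathcomp Require Import all_classical all_reals topology normedtype.

Set Implicit Arguments.
Unset Strict Implicit.
Unset Printing Implicit Defensive.

Import Order.TTheory GRing.Theory Num.Theory numFieldTopology.Exports.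

(* Conventions: a partition is a weakly decreasing seq of positive naturals.
   Cells are pairs (row, column), 0-INDEXED here: the paper's cell c_{i,j}
   is (i-1, j-1).  Row 1 of the paper is row 0 here. *)

Definition is_partition (l : seq nat) : bool :=
  sorted geq l && all (fun x => 0 < x) l.

Definition in_diag (lam : seq nat) (c : nat * nat) : bool :=
  (c.1 < size lam) && (c.2 < nth 0 lam c.1).

Definition rim (lam : seq nat) (c : nat * nat) : bool :=
  in_diag lam c &&
  (in_diag lam (c.1, c.2.+1) + in_diag lam (c.1.+1, c.2)
     + in_diag lam (c.1.+1, c.2.+1) < 3).

(* A set P of cells is a ribbon corresponding to the descent set I:
   there is an enumeration r = [cell 1; ...; cell n] of P (from lower-left to
   upper-right), each successive cell directly right of or directly above the
   previous one, and I = { i in {1..n-1} | cell i directly below cell i+1 }.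
   (cell i of the paper is nth (0,0) r (i-1).) *)
Definition ribbon_for (P : pred (nat * nat)) (I : {fset nat}) : Prop :=
  exists r : seq (nat * nat),
    [/\ uniq r,
        forall c, P c = (c \in r),
        forall k, k.+1 < size r ->
          let p := nth (0,0) r k in let q := nth (0,0) r k.+1 in
          (q == (p.1, p.2.+1)) || ((q.1.+1 == p.1) && (q.2 == p.2))
      & forall i, (i \in I) =
          [&& 1 <= i, i < size r &
              let p := nth (0,0) r i.-1 in let q := nth (0,0) r i in
              (q.1.+1 == p.1) && (q.2 == p.2)]].

Definition descent_set (I : {fset nat}) : Prop :=
  I != fset0 /\ forall i, i \in I -> 0 < i.

Definition is_lambdaI (I : {fset nat}) (lam : seq nat) : Prop :=
  [/\ is_partition lam, nth 0 lam 0 = nth 0 lam 1 & ribbon_for (rim lam) I].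

Definition is_muI (lam mu : seq nat) : Prop :=
  [/\ is_partition mu,
      forall c, in_diag mu c -> in_diag lam c
    & forall c, rim lam c = in_diag lam c && ~~ in_diag mu c].

Definition s_of (lam : seq nat) : nat := (nth 0 lam 0).-1.

Section Excited.
Variable B : nat.
Definition cell := ('I_B * 'I_B)%type.
Definition coord (c : cell) : nat * nat := (val c.1, val c.2).

Definition diag (lam : seq nat) : {set cell} :=
  [set c | in_diag lam (coord c)].

Definition memD (D : {set cell}) (p : nat * nat) : bool :=
  [exists c in D, coord c == p].

Definition emove (lam : seq nat) : rel {set cell} := fun D D' =>
  [exists c in D, exists c' : cell,
     [&& coord c' == ((coord c).1.+1, (coord c).2.+1),
         c' \in diag lam,
         ~~ memD D ((coord c).1, (coord c).2.+1),
         ~~ memD D ((coord c).1.+1, (coord c).2),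
         ~~ memD D ((coord c).1.+1, (coord c).2.+1) &
         D' == c' |: (D :\ c)]].

Definition excited (lam mu : seq nat) : {set {set cell}} :=
  [set D | connect (emove lam) (diag mu) D].

Definition hook (lam : seq nat) (c : cell) : nat :=
  #|[set c' in diag lam |
      ((c'.1 == c.1) && (c.2 <= c'.2)) || ((c'.2 == c.2) && (c.1 <= c'.1))]|.

Definition row1 (D : {set cell}) : {set cell} := [set c in D | val c.1 == 0].

Definition NNcoef_in (lam mu : seq nat) (j : nat) : nat :=
  \sum_(D in excited lam mu | #|row1 D| == s_of lam - j)
     \prod_(c in D | val c.1 != 0) hook lam c.
End Excited.

(* a box large enough to contain D(lam) *)
Definition box (lam : seq nat) : nat := size lam + nth 0 lam 0.

Definition NNcoef (lam mu : seq nat) (j : nat) : nat :=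
  NNcoef_in (box lam) lam mu j.

Definition Tset (R : realType) (a : nat) : set R :=
  [set x | exists (I : {fset nat}) (lam mu : seq nat),
     [/\ descent_set I, is_lambdaI I lam, is_muI lam mu,
         a.+1 <= s_of lam &
         NNcoef lam mu (s_of lam - a) != 0 /\
         x = ((NNcoef lam mu (s_of lam - a).-1)%:R
             / (NNcoef lam mu (s_of lam - a))%:R)%R]].

(* Main.v *)
Require Import Defs.
From HB Require Import structures.
From mathcomp Require Import all_boot all_order all_algebra.
From mathcomp Require Import finmap zify lra.
From mathcomp Require Import all_classical all_reals topology normedtype.

(* Rectangles suffice. The excited diagrams of [lambda / mu] correspond to the
   partitions contained in mu (the cells that have not moved), with the first
   part counting the cells in row 1. For the rectangle with n+2 rows and M+1
   columns, mu has n+1 rows and M columns, and summing the hook products row by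
   row from the bottom gives by induction
     C_{s-a} = K * binomial (n+a, a) * (M-a)!   with K independent of a,
   so the ratio C_{s-a-1} / C_{s-a} is (n+1+a) / ((a+1) (M-a)). These ratios
   exhaust the positive rationals for each a. Conversely the elements of T_a are
   nonnegative rationals, and for a = 0 the numerator is positive because some
   excited diagram has exactly one cell in row 1. *)

Set Implicit Arguments.
Unset Strict Implicit.
Unset Printing Implicit Defensive.

Import Order.TTheory GRing.Theory Num.Theory numFieldTopology.Exports.
Local Open Scope nat_scope.

(** * Partitions and the inner shape *)

Lemma in_diagE (lam : seq nat) (i j : nat) :
  in_diag lam (i, j) = (j < nth 0 lam i).
Proof.
by rewrite /in_diag /=; case: ltnP => //= le_i; rewrite nth_default.
Qed.

Lemma nth_partition_anti (lam : seq nat) (i : nat) :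
  is_partition lam -> nth 0 lam i.+1 <= nth 0 lam i.
Proof.
case/andP=> sl _; case: (ltnP i.+1 (size lam)) => hi; last by rewrite nth_default.
by move/(sortedP 0)/(_ i hi): sl.
Qed.

Lemma nth_partition_head (lam : seq nat) (i : nat) :
  is_partition lam -> nth 0 lam i <= nth 0 lam 0.
Proof.
move=> lamP; elim: i => // i IHi.
exact: leq_trans (nth_partition_anti i lamP) IHi.
Qed.

(* [is_muI_inner]: this is the relation between [lambda^I] and [mu^I]: the
   latter is the former without its first row and column. *)
Definition inner (lam mu : seq nat) : Prop :=
  [/\ is_partition lam, is_partition mu &
      forall i j, (j < nth 0 mu i) = (j.+1 < nth 0 lam i.+1)].

(** In a partition the diagonal neighbour forces the other two, so a cell of lambda is off the rim
    exactly when its diagonal neighbour lies in lambda. *)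
Lemma is_muI_inner (lam mu : seq nat) :
  is_partition lam -> is_muI lam mu -> inner lam mu.
Proof.
move=> lamP [muP sub rimE]; split=> // i j.
move: (rimE (i, j)) (sub (i, j)); rewrite /rim !in_diagE /=.
have := nth_partition_anti i lamP.
by case: (ltnP j (nth 0 mu i)); lia.
Qed.

(** * Excited diagrams as partitions inside mu *)

(* An excited diagram is encoded by the numbers [f i] of cells of row [i] of mu
   that stay in place; the other cells of mu move exactly once. *)
Definition unmoved_rows (mu : seq nat) (f : nat -> nat) : Prop :=
  forall i, f i <= nth 0 mu i /\ f i.+1 <= f i.

(** A moved cell [(i.-1, k)], with [f i.-1 <= k], lands at [(i, k.+1)]; hence the shifted bounds on
    [j]. *)
Definition in_moved (mu : seq nat) (f : nat -> nat) (i j : nat) : bool :=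
  (j < f i) || ((0 < i) && (f i.-1 < j <= nth 0 mu i.-1)).

Definition moved_diag (B : nat) (mu : seq nat) (f : nat -> nat) : {set cell B} :=
  [set c : cell B | in_moved mu f c.1 c.2].

Section ExcitedDiagrams.
Variables (lam mu : seq nat).
Hypothesis lam_mu : inner lam mu.
Notation B := (box lam).

Lemma diag_in_box (i j : nat) : j < nth 0 lam i -> (i < B) && (j < B).
Proof.
move=> hj; case: lam_mu => lamP _ _; have := nth_partition_head i lamP.
have: i < size lam by rewrite ltnNge; apply/negP => /(nth_default 0) h; lia.
rewrite /box; lia.
Qed.

Lemma in_moved_diag (f : nat -> nat) (i j : nat) :
  unmoved_rows mu f -> in_moved mu f i j -> j < nth 0 lam i.
Proof.
case: lam_mu => lamP _ lmE fP; have [fi _] := fP i.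
have := lmE i j; have := nth_partition_anti i lamP.
case: i fi => [|i] fi; rewrite /in_moved /=; first by lia.
have := lmE i j.-1; lia.
Qed.

Lemma memD_moved (f : nat -> nat) (i j : nat) :
  unmoved_rows mu f -> memD (moved_diag B mu f) (i, j) = in_moved mu f i j.
Proof.
move=> fP; apply/idP/idP => [/existsP[d /andP[+ /eqP[<- <-]]]|h].
  by rewrite inE.
have /andP[hi hj] := diag_in_box (in_moved_diag fP h).
by apply/existsP; exists (Ordinal hi, Ordinal hj); rewrite inE h /= eqxx.
Qed.

Lemma diag_moved : diag B mu = moved_diag B mu (nth 0 mu).
Proof.
by apply/setP => -[i j]; rewrite !inE in_diagE /in_moved /=; lia.
Qed.

Lemma moved_diag_ext (f g : nat -> nat) :
  f =1 g -> moved_diag B mu f = moved_diag B mu g.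
Proof. by move=> fg; apply/setP => c; rewrite !inE /in_moved !fg. Qed.

(** Only two rows change: row [c.1] loses its last unmoved cell [c], and the row below gains [c']
    just left of its moved cells. *)
Lemma moved_diag_step (f g : nat -> nat) (c c' : cell B) :
    unmoved_rows mu f ->
    f c.1 = (c.2 : nat).+1 -> c.2 < nth 0 mu c.1 ->
    Defs.coord c' = ((Defs.coord c).1.+1, (Defs.coord c).2.+1) ->
    (forall i, g i = if i == c.1 then (c.2 : nat) else f i) ->
  c' |: (moved_diag B mu f :\ c) = moved_diag B mu g.
Proof.
case: c c' => [i j] [i' j'] fP /= fi hj [] hi' hj' gE.
apply/setP => -[k l]; rewrite !inE !xpair_eqE -!val_eqE /= hi' hj' /in_moved !gE.
have [fi1 fi2] := fP i; have := fP k.-1.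
case: (k : nat) => [|k'] /=.
  case: (0 =P i :> nat) => [e|ne]; last by lia.
  by move: hj fi fi1 fi2; rewrite -e /=; lia.
case: (k'.+1 =P i :> nat) => [e|ne] [h1 h2].
  by move: h2; rewrite e fi (_ : (k' == i) = false); lia.
case: (k' =P i :> nat) => [e|ne']; last by lia.
by move: h2; rewrite e fi; lia.
Qed.

(* Moves are undone one at a time, each in the topmost row that has a moved cell. *)
Lemma moved_diag_excited (f : nat -> nat) :
  unmoved_rows mu f -> moved_diag B mu f \in excited B lam mu.
Proof.
case: lam_mu => lamP muP lmE.
have [n] := ubnP (\sum_(i < size mu) (nth 0 mu i - f i)).
elim: n f => // n IHn f le_n fP; rewrite inE.
case: (pselect (exists i, f i < nth 0 mu i)) => [exi|nexi]; last first.
  rewrite diag_moved (@moved_diag_ext (nth 0 mu) f) ?connect0 // => i.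
  have [fi _] := fP i; apply/eqP; rewrite eqn_leq fi andbT leqNgt.
  by apply/negP => h; apply: nexi; exists i.
case: (ex_minnP exi) => i hi imin {exi}.
pose g k := if k == i then (f i).+1 else f k.
have isz : i < size mu.
  by rewrite ltnNge; apply/negP => /(nth_default 0) h; lia.
have gP : unmoved_rows mu g.
  move=> k; rewrite /g; have [h1 h2] := fP k; have := fP i.
  case: (k =P i) => [->|nk].
    by rewrite (_ : (i.+1 == i) = false); lia.
  split=> //; case: (k.+1 =P i) => [e|//].
  (* Row [k], just above [i], has no moved cell by minimality of [i], so it is long enough to bound
     the enlarged row. *)
  have : ~~ (f k < nth 0 mu k) by apply/negP => /imin; lia.
  have := nth_partition_anti k muP; rewrite e; lia.
have gf : \sum_(k < size mu) (nth 0 mu k - g k) < n.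
  apply: leq_trans (_ : _ <= \sum_(k < size mu) (nth 0 mu k - f k)) _; last by lia.
  rewrite (bigD1 (Ordinal isz)) //= [X in _ < X](bigD1 (Ordinal isz)) //=.
  rewrite /g eqxx (eq_bigr (fun k : 'I_(size mu) => nth 0 mu k - f k)); first by lia.
  by move=> k; rewrite -val_eqE /= => /negbTE ->.
have := IHn g gf gP; rewrite inE => /connect_trans; apply; apply: connect1.
have hlam : (f i).+1 < nth 0 lam i.+1 by rewrite -lmE.
have /andP[hi1 hj1] := diag_in_box hlam.
have hi0 : i < B by lia.
have hj0 : f i < B by lia.
pose c : cell B := (Ordinal hi0, Ordinal hj0).
pose c' : cell B := (Ordinal hi1, Ordinal hj1).
apply/existsP; exists c; apply/andP; split.
  by rewrite inE /in_moved /= /g eqxx ltnSn.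
apply/existsP; exists c'; rewrite /= eqxx inE in_diagE hlam /=.
have [fi1 fi2] := fP i.
have gE : g i = (f i).+1 by rewrite /g eqxx.
have gS : g i.+1 = f i.+1 by rewrite /g; case: eqP => //; lia.
rewrite !memD_moved // /in_moved /= gE gS.
rewrite (@moved_diag_step g f c c') ?eqxx //=; last first.
  by move=> k; rewrite /g; case: eqP => // ->.
have [g1 g2] := gP i.-1; have := imin i.-1.
case: (i) g1 g2 gE fi2 => [|k] /=; rewrite ?andbT ?orbF; first by lia.
move=> g1 + gE; rewrite gE => g2 fi2 _; lia.
Qed.

(** The encoding survives each move. A movable cell lies in mu because its target lies in lambda.
    Were it already moved, its right neighbour would be occupied too; so it is the last unmoved cell
    of its row. The free cell below keeps the row counts decreasing. *)
Lemma excited_moved_diag (D : {set cell B}) :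
  D \in excited B lam mu ->
  exists2 f, unmoved_rows mu f & D = moved_diag B mu f.
Proof.
case: lam_mu => lamP muP lmE; rewrite inE => /connectP[p + ->].
have : exists2 f, unmoved_rows mu f & diag B mu = moved_diag B mu f.
  by exists (nth 0 mu); [move=> i; rewrite nth_partition_anti | rewrite diag_moved].
elim: p (diag B mu) => [|D' p IHp] D0 /= exD0; first by [].
case/andP=> D0D'; apply: IHp; case: exD0 => f fP D0E {p}.
case/existsP: D0D' => c /andP[]; rewrite D0E => cD /existsP[c'].
case/and5P=> /eqP c'E c'lam; rewrite !memD_moved //.
move=> n1 n2 /andP[n3 /eqP ->].
move: cD c'lam; rewrite !inE c'E in_diagE -lmE /= => cD cmu.
have [fi fi2] := fP c.1.
have fcE : f c.1 = (c.2 : nat).+1.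
  move: cD n1 n2 n3; rewrite /in_moved /= /Defs.coord /=; case: (c.1 : nat) cmu fi fi2 => [|i] /=.
    by lia.
  have := nth_partition_anti i muP.
  by have := fP i; lia.
exists (fun i : nat => if i == c.1 then (c.2 : nat) else f i); last first.
  exact: moved_diag_step.
move=> i; have [h1 h2] := fP i; case: (i =P c.1 :> nat) => [->|ne].
  rewrite (_ : ((c.1 : nat).+1 == c.1) = false); last by lia.
  by move: n2; rewrite /in_moved /Defs.coord /=; lia.
by case: (i.+1 =P c.1 :> nat) => [e|//]; rewrite e fcE in h2; lia.
Qed.

(** If [u i < v i], the cell [(i, u i)] lies in the diagram of [v] but not in that of [u]: cells
    entering row [i] from above land right of column [u i.-1], which is at least [u i]. *)
Lemma moved_diag_inj (f g : nat -> nat) :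
    unmoved_rows mu f -> unmoved_rows mu g ->
  moved_diag B mu f = moved_diag B mu g -> f =1 g.
Proof.
have le (u v : nat -> nat) : unmoved_rows mu u -> unmoved_rows mu v ->
    moved_diag B mu u = moved_diag B mu v -> forall i, v i <= u i.
  move=> uP vP E i; rewrite leqNgt; apply/negP => lt_uv.
  have : in_moved mu v i (u i) by rewrite /in_moved lt_uv.
  rewrite -memD_moved // -E memD_moved // /in_moved ltnn /=.
  by case: i lt_uv => //= i _; have := uP i; lia.
move=> fP gP E i; apply/eqP; rewrite eqn_leq.
by rewrite (le g f gP fP (esym E)) (le f g fP gP E).
Qed.

Lemma card_row1_moved_diag (f : nat -> nat) :
  unmoved_rows mu f -> #|Defs.row1 (moved_diag B mu f)| = f 0.
Proof.
move=> fP; case: lam_mu => lamP muP lmE; have [f0 _] := fP 0.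
case: (posnP (nth 0 mu 0)) => mu0.
  have f00 : f 0 = 0 by lia.
  rewrite f00; apply/eqP; rewrite cards_eq0; apply/eqP/setP => -[i j].
  rewrite !inE /in_moved /=; apply/negP => /andP[+ /eqP i0].
  by rewrite i0 f00.
have hB : nth 0 mu 0 < B.
  have : (nth 0 mu 0).-1 < nth 0 mu 0 by lia.
  rewrite lmE => /diag_in_box; lia.
have B0 : 0 < B by lia.
have fB : f 0 <= B by lia.
pose h (j : 'I_(f 0)) : cell B := (Ordinal B0, widen_ord fB j).
have hI : injective h by move=> j k [] /val_inj.
rewrite -[RHS]card_ord -(card_imset _ hI); apply: eq_card => -[i j].
rewrite !inE /in_moved /=; apply/andP/imsetP => [[+ /eqP i0]|[k _ [-> ->]]].
  rewrite i0 /= orbF => hj; exists (Ordinal hj) => //.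
  by congr pair; apply: val_inj.
by rewrite /= ltn_ord.
Qed.

(** The single diagram of [f] already contributes a positive term, since every hook contains its own
    corner. *)
Lemma NNcoef_gt0 (f : nat -> nat) :
    unmoved_rows mu f -> f 0 <= s_of lam -> 0 < NNcoef lam mu (s_of lam - f 0).
Proof.
move=> fP fs; rewrite /NNcoef /NNcoef_in (bigD1 (moved_diag B mu f)) /=; last first.
  by rewrite moved_diag_excited // card_row1_moved_diag // subKn ?eqxx.
rewrite addn_gt0; apply/orP; left; apply: prodn_cond_gt0 => c /andP[cD _].
apply/card_gt0P; exists c; rewrite !inE !eqxx !leqnn /= andbT /Defs.coord in_diagE.
by apply: in_moved_diag fP _; rewrite inE in cD.
Qed.

End ExcitedDiagrams.

(** * Summation of hook products row by row *)

Lemma big_tuple_cons (R : Type) (idx : R) (op : Monoid.com_law idx)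
    (T : finType) (n : nat) (F : n.+1.-tuple T -> R) :
  \big[op/idx]_(t : n.+1.-tuple T) F t =
  \big[op/idx]_(u : T) \big[op/idx]_(s : n.-tuple T) F (cons_tuple u s).
Proof.
rewrite pair_bigA /=.
rewrite (reindex (fun p : T * n.-tuple T => cons_tuple p.1 p.2)) //=.
exists (fun t : n.+1.-tuple T => (thead t, [tuple of behead t])) => [[u s] _|t _].
  by rewrite theadE; congr pair; apply: val_inj.
by rewrite [RHS]tuple_eta.
Qed.

(* The product of the hook lengths of the cells of an excited diagram lying in
   the [x]-th row from the bottom of a rectangle with [M + 1] columns, when [u]
   cells stay in place in this row and [v] in the row above it. *)
Definition row_weight (M x v u : nat) : nat :=
  \prod_(j < M.+1 | (j < u) || (v < j)) (x + (M - j)).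

(** The unmoved cells give a falling factorial; the factors right of column [v] run from
    [x + (M - v)] down to [x.+1], a quotient of factorials. *)
Lemma row_weight_fact (M x v u : nat) :
  u <= v -> v <= M ->
  row_weight M x.+1 v u * x`! = (x.+1 + M) ^_ u * (x + (M - v))`!.
Proof.
move=> uv vM; rewrite /row_weight.
rewrite -(big_mkord (fun j => (j < u) || (v < j)) (fun j => x.+1 + (M - j))).
have uM : u <= M.+1 by lia.
have uv1 : u <= v.+1 by lia.
rewrite (big_cat_nat _ uM) //= (big_cat_nat uv1 (vM : v < M.+1)) /=.
rewrite [X in _ * (X * _)]big_nat_cond [X in _ * (X * _)]big_pred0; last by move=> j; lia.
rewrite mul1n -mulnA; congr (_ * _).
  rewrite ffact_prod -(big_mkord xpredT (fun i => x.+1 + M - i)).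
  rewrite big_nat_cond [RHS]big_nat_cond; apply: eq_big => j; lia.
have -> : (x + (M - v))`! = (x + (M - v)) ^_ (M - v) * (x + (M - v) - (M - v))`!.
  by rewrite ffact_fact //; lia.
rewrite addnK ffact_prod -(big_mkord xpredT (fun i => x + (M - v) - i)).
congr (_ * _); rewrite -[v.+1]add0n big_addn subSS.
by rewrite big_nat_cond [RHS]big_nat_cond; apply: eq_big => j; lia.
Qed.

(** This sums out one row in [sum_chain]. Induction on [v] reduces it to Pascal's rule [e4] and the
    absorption identity [e5]. *)
Lemma sum_ffact_bin (M n v : nat) : v <= M ->
  (\sum_(u < v.+1) (n.+2 + M) ^_ u * ('C(n + u, u) * (M - u)`!)) * (n.+1 + (M - v))`!
  = (n.+1 + M)`! * ('C(n.+1 + v, v) * (M - v)`!).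
Proof.
elim: v => [|v IHv] vM.
  by rewrite big_ord1 ffactn0 !addn0 !bin0 subn0 mulnC !mul1n.
rewrite big_ord_recr /= mulnDl.
have {IHv} := IHv (ltnW vM); set S := \sum_(u < v.+1) _ => IHv.
have [b Mb] : exists b, M = v.+1 + b by exists (M - v.+1); lia.
have e1 : M - v = b.+1 by lia.
have e2 : M - v.+1 = b by lia.
rewrite e1 e2 in IHv *.
have h1 : (n.+1 + b.+1)`! = (n.+1 + b).+1 * (n.+1 + b)`! by rewrite addnS factS.
have h2 : b.+1`! = b.+1 * b`! by rewrite factS.
have e3 : (n.+2 + M) ^_ v.+1 * ((n.+1 + b).+1 * (n.+1 + b)`!) =
          (n.+2 + M) * (n.+1 + M)`!.
  have le_v : v.+1 <= n.+2 + M by lia.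
  have d : n.+2 + M - v.+1 = (n.+1 + b).+1 by lia.
  by have := ffact_fact le_v; rewrite d [(n.+1 + b).+1`!]factS => ->; rewrite -factS.
have e4 : 'C(n.+1 + v.+1, v.+1) = 'C(n + v.+1, v.+1) + 'C(n.+1 + v, v).
  by rewrite addSn binS addnS addSn.
have e5 : v.+1 * 'C(n + v.+1, v.+1) = n.+1 * 'C(n.+1 + v, v).
  have := mul_bin_left (n.+1 + v) v; rewrite -addSnnS => ->; congr (_ * _); lia.
(* The extra factor completes the factorial that occurs in the induction hypothesis and in [e3]. *)
apply/eqP; rewrite -(eqn_pmul2r (ltn0Sn (n.+1 + b))); apply/eqP.
rewrite e4; move: e3 e5 IHv; rewrite h1 h2 Mb.
move: 'C(_, _) 'C(_, _) (_ ^_ _) => X Y W.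
move: (n.+1 + b)`! (n.+1 + (v.+1 + b))`! b`! => f1 f2 f3.
move=> e3 e5 IHv.
rewrite [LHS](_ : _ = S * ((n.+1 + b).+1 * f1) + W * ((n.+1 + b).+1 * f1) * (Y * f3));
  last by lia.
rewrite {}IHv {}e3.
(* After cancellation this is exactly [e5]. *)
have E : X * b.+1 + (n.+2 + (v.+1 + b)) * Y = (n.+1 + b).+1 * (Y + X) by lia.
transitivity (f2 * f3 * (X * b.+1 + (n.+2 + (v.+1 + b)) * Y)); first by lia.
by rewrite E; lia.
Qed.

(* The value is 0 unless [v :: s] is weakly decreasing. *)
Fixpoint chain (M v : nat) (s : seq nat) : nat :=
  if s is u :: s' then (u <= v) * (row_weight M (size s').+2 v u * chain M u s')
  else row_weight M 1 v 0.

(** The last factor reads the default 0 past the end of [s]: the bottom row of the rectangle is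
    outside mu, so nothing stays in place there. *)
Lemma chainE (M v : nat) (s : seq nat) :
  chain M v s = sorted geq (v :: s) *
   \prod_(i < (size s).+1)
      row_weight M ((size s).+1 - i) (nth 0 (v :: s) i) (nth 0 (v :: s) i.+1).
Proof.
elim: s v => [|u s IHs] v; first by rewrite big_ord1 /= mul1n.
rewrite big_ord_recl /= IHs /= subn0.
by case: (u <= v); rewrite ?mul0n // !mul1n mulnCA; congr (_ * (_ * _)).
Qed.

Definition chain_const (M n : nat) : nat := \prod_(k < n) (k.+1 + M) ^_ M.

(** Induction on the number of rows: the inner sum is known for each first entry [u], and
    [sum_ffact_bin] evaluates the sum over [u]. *)
Lemma sum_chain (M n v : nat) : v <= M ->
  \sum_(s : n.-tuple 'I_M.+1) chain M v (map val s) =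
  chain_const M n * ('C(n + v, v) * (M - v)`!).
Proof.
elim: n v => [|n IHn] v vM.
  rewrite /chain_const big_ord0 (bigD1 [tuple]) //= big1; last first.
    by move=> s /eqP[]; apply: tuple0.
  rewrite addn0 binn !mul1n -[LHS]muln1 -{1}fact0 row_weight_fact //.
  by rewrite ffactn0 mul1n.
rewrite big_tuple_cons /=.
(* The factorial of [n.+1] makes [row_weight_fact] applicable to row [n.+2] from the bottom; it is
   cancelled afterwards. *)
have split_u (u : 'I_M.+1) :
    \sum_(s : n.-tuple 'I_M.+1) chain M v (map val (cons_tuple u s)) * n.+1`! =
    (n.+1 + (M - v))`! * chain_const M n *
     ((u < v.+1) * ((n.+2 + M) ^_ u * ('C(n + u, u) * (M - u)`!))).
  rewrite -big_distrl /=.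
  under eq_bigr => s _ do rewrite size_map size_tuple.
  rewrite -big_distrr -big_distrr /= IHn -1?ltnS ?ltn_ord // ltnS.
  case: leqP => uv; last by rewrite !mul0n muln0.
  by rewrite !mul1n mulnAC row_weight_fact //; lia.
apply/eqP; rewrite -(eqn_pmul2r (fact_gt0 n.+1)) big_distrl /=; apply/eqP.
under eq_bigr => u _ do rewrite big_distrl /= split_u.
rewrite -big_distrr /=.
have -> : \sum_(u < M.+1) ((u < v.+1) * ((n.+2 + M) ^_ u * ('C(n + u, u) * (M - u)`!)))
   = \sum_(u < v.+1) ((n.+2 + M) ^_ u * ('C(n + u, u) * (M - u)`!)).
  rewrite (big_ord_widen M.+1 (fun u => (n.+2 + M) ^_ u * ('C(n + u, u) * (M - u)`!))) //.
  rewrite [RHS]big_mkcond; apply: eq_bigr => u _.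
  by case: ltnP; rewrite ?mul1n ?mul0n.
have ffK : (n.+1 + M) ^_ M * n.+1`! = (n.+1 + M)`!.
  by rewrite -(@ffact_fact (n.+1 + M) M) ?addnK ?leq_addl.
rewrite mulnC mulnA sum_ffact_bin // -ffK.
rewrite /chain_const big_ord_recr /=; lia.
Qed.

Lemma chain_const_gt0 (M n : nat) : 0 < chain_const M n.
Proof. by apply: prodn_gt0 => k; rewrite ffact_gt0 leq_addl. Qed.

(** * Coefficients of rectangles *)

Lemma card_ord_interval (B a b : nat) :
  b <= B -> #|[set y : 'I_B | a <= y < b]| = b - a.
Proof.
move=> bB; rewrite -sum1dep_card.
rewrite -(big_ord_widen_cond _ (fun y => a <= y) (fun=> 1) bB).
rewrite -(big_mkord (fun y => a <= y) (fun=> 1)).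
case: (leqP a b) => ab; last first.
  by rewrite big_nat_cond big_pred0; [lia | move=> i; lia].
rewrite (big_cat_nat _ ab) //= big_nat_cond big_pred0 /=; last by move=> i; lia.
rewrite big_nat_cond (eq_bigl (fun i => (a <= i < b) && true)) -?big_nat_cond.
  by rewrite sum_nat_const_nat muln1.
by move=> i /=; lia.
Qed.

Lemma nseq_partition (k x : nat) : 0 < x -> is_partition (nseq k x).
Proof.
move=> x0; rewrite /is_partition all_nseq x0 orbT andbT.
apply/(sortedP 0) => i; rewrite size_nseq => ik.
by rewrite !nth_nseq ik (ltn_trans _ ik) /=.
Qed.

Section Rectangle.
Variables n M : nat.
Let lam : seq nat := nseq n.+2 M.+1.
Let mu : seq nat := nseq n.+1 M.
Hypothesis M_gt0 : 0 < M.
Notation B := (box lam).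

Lemma nth_rect_lam (i : nat) : nth 0 lam i = if i < n.+2 then M.+1 else 0.
Proof. by rewrite nth_nseq. Qed.

Lemma nth_rect_mu (i : nat) : nth 0 mu i = if i < n.+1 then M else 0.
Proof. by rewrite nth_nseq. Qed.

Lemma rect_is_muI : is_muI lam mu.
Proof.
split; first exact: nseq_partition.
  move=> [i j]; rewrite !in_diagE nth_rect_lam nth_rect_mu.
  by case: (ltnP i n.+1); case: (ltnP i n.+2); lia.
move=> [i j]; rewrite /rim /= !in_diagE !nth_rect_lam !nth_rect_mu !ltnS.
by case: (ltngtP i n.+1); case: (leqP i n); lia.
Qed.

Lemma rect_inner : inner lam mu.
Proof. by apply: is_muI_inner rect_is_muI; apply: nseq_partition. Qed.

Lemma rect_box : B = n.+2 + M.+1.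
Proof. by rewrite /box size_nseq. Qed.

Lemma rect_hook (c : cell B) :
  c.1 < n.+2 -> c.2 < M.+1 -> hook lam c = (n.+2 - c.1) + (M - c.2).
Proof.
case: c => i j /= hi hj; rewrite /hook.
have -> : [set c' in diag B lam | ((c'.1 == i) && (j <= c'.2))
              || ((c'.2 == j) && (i <= c'.1))]
   = finset.setX [set i] [set y : 'I_B | j <= y < M.+1] :|:
     finset.setX [set x : 'I_B | i.+1 <= x < n.+2] [set j].
  apply/setP => -[x y]; rewrite !inE in_diagE /= nth_rect_lam -!val_eqE /=.
  by case: (ltnP x n.+2); case: (ltngtP x i); case: (ltngtP y j); lia.
rewrite cardsU (_ : _ :&: _ = finset.set0) ?cards0; last first.
  by apply/setP => -[x y]; rewrite !inE -!val_eqE /=; lia.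
rewrite !cardsX !cards1 !card_ord_interval ?rect_box; lia.
Qed.

Lemma unmoved_seqP (t : seq nat) : size t = n.+1 ->
  (sorted geq t && all (fun x => x <= M) t) <-> unmoved_rows mu (nth 0 t).
Proof.
move=> st; split=> [/andP[/(sortedP 0) st' /(all_nthP 0) at'] i|H].
  rewrite nth_rect_mu -st; split.
    by case: ltnP => hi; [exact: at' | rewrite nth_default].
  by case: (ltnP i.+1 (size t)) => hi; [exact: st' | rewrite nth_default].
apply/andP; split.
  by apply/(sortedP 0) => i hi; have [_] := H i.
by apply/(all_nthP 0) => i hi; have [] := H i; rewrite nth_rect_mu -st hi.
Qed.

(** Row [i.+1] is the [n.+1 - i]-th from the bottom; it holds its own unmoved cells and the cells
    moved out of row [i]. *)
Lemma rect_weight (f : nat -> nat) : unmoved_rows mu f ->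
  \prod_(c in moved_diag B mu f | c.1 != 0 :> nat) hook lam c =
  \prod_(i < n.+1) row_weight M (n.+1 - i) (f i) (f i.+1).
Proof.
move=> fP.
pose P (i j : nat) := in_moved mu f i j && (i != 0).
pose hk (i j : nat) := (n.+2 - i) + (M - j).
have PE i j : P i.+1 j = (i < n.+1) && (j < M.+1) && ((j < f i.+1) || (f i < j)).
  have [h1 _] := fP i.+1; have [h2 _] := fP i.
  move: h1 h2; rewrite nth_rect_mu /P /in_moved /= !nth_rect_mu.
  by case: (ltnP i.+1 n.+1); case: (ltnP i n.+1); lia.
transitivity (\prod_(i < B) \prod_(j < B | P i j) hk i j).
  rewrite pair_big_dep /=; apply: eq_big => [[i j]|[i j] /andP[cD _]].
    by rewrite !inE.
  rewrite inE in cD; have := in_moved_diag rect_inner fP cD.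
  rewrite nth_rect_lam; case: (ltnP (i, j).1 n.+2) => // h1 h2.
  by rewrite rect_hook.
rewrite -(big_mkord xpredT (fun i => \prod_(j < B | P i j) hk i j)).
have B0 : 0 < B by rewrite rect_box.
rewrite big_ltn // [X in X * _]big_pred0 ?mul1n; last by move=> j; rewrite /P /= andbF.
have nB : n.+2 <= B by rewrite rect_box; lia.
rewrite (big_cat_nat _ nB) //= [X in _ * X]big_nat_cond.
rewrite [X in _ * X]big1 ?muln1; last first.
  move=> [|i] /andP[/andP[hi _] _] //; apply: big_pred0 => j.
  by rewrite PE; lia.
rewrite big_add1 big_mkord; apply: eq_bigr => i _.
have MB : M.+1 <= B by rewrite rect_box; lia.
rewrite /row_weight.
rewrite (big_ord_widen_cond _ (fun j => (j < f i.+1) || (f i < j))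
          (fun j => n.+1 - i + (M - j)) MB).
apply: eq_big => j; first by rewrite PE ltn_ord /= andbC.
by rewrite /hk subSS.
Qed.

Definition rect_rows (a : nat) (s : n.-tuple 'I_M.+1) : nat -> nat :=
  nth 0 (a :: map val s).

(** Decreasing tuples bounded by [a] and [M] parametrize the excited diagrams with [a] cells in row
    1; on all other tuples [chain] vanishes. *)
Lemma sum_excited_rect (a : nat) : a <= M ->
  \sum_(D in excited B lam mu | #|Defs.row1 D| == a)
     \prod_(c in D | val c.1 != 0) hook lam c =
  \sum_(s : n.-tuple 'I_M.+1) chain M a (map val s).
Proof.
move=> aM.
pose Q (s : n.-tuple 'I_M.+1) := sorted geq (a :: map val s).
have sz (s : n.-tuple 'I_M.+1) : size (a :: map val s) = n.+1.
  by rewrite /= size_map size_tuple.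
have QP s : Q s <-> unmoved_rows mu (rect_rows a s).
  rewrite -(unmoved_seqP (sz s)) -/(Q s) /= aM /=.
  rewrite (_ : all _ _ = true) ?andbT //.
  by apply/allP => x /mapP[y _ ->]; rewrite -ltnS.
rewrite (eq_bigl (fun D => D \in
    [set moved_diag B mu (rect_rows a s) | s in [set s | Q s]])); last first.
  move=> D; apply/andP/imsetP => [[Dex rowD]|[s]].
    have [f fP DE] := excited_moved_diag rect_inner Dex.
    move: rowD; rewrite DE (card_row1_moved_diag rect_inner fP) => /eqP f0.
    have [s sE] : exists s : n.-tuple 'I_M.+1, forall i, tnth s i = inord (f i.+1).
      by exists [tuple inord (f i.+1) | i < n] => i; rewrite tnth_mktuple.
    have fE : rect_rows a s =1 f.
      case=> [|i]; first by rewrite /rect_rows /= f0.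
      rewrite /rect_rows /=; have [+ _] := fP i.+1; rewrite nth_rect_mu ltnS.
      case: ltnP => hi le_f; last first.
        by rewrite nth_default ?size_map ?size_tuple //; lia.
      rewrite (nth_map ord0) ?size_tuple //.
      rewrite (_ : nth ord0 _ i = tnth s (Ordinal hi)); last first.
        by rewrite (tnth_nth ord0).
      by rewrite sE inordK.
    exists s; last by apply: esym; apply: moved_diag_ext.
    by rewrite inE; apply/QP => i; rewrite !fE.
  rewrite inE => /QP sP ->.
  by rewrite (moved_diag_excited rect_inner) // (card_row1_moved_diag rect_inner).
rewrite big_imset /=; last first.
  move=> s t; rewrite !inE => /QP sP /QP tP.
  move/(moved_diag_inj rect_inner sP tP) => E.
  apply: eq_from_tnth => i; apply: val_inj.
  have := E i.+1; rewrite /rect_rows /= !(nth_map ord0) ?size_tuple //.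
  by rewrite !(tnth_nth ord0).
rewrite big_mkcond; apply: eq_bigr => s _.
rewrite chainE inE /Q; case: ifP => [Qs|]; last by rewrite mul0n.
rewrite mul1n rect_weight; last exact/QP.
by rewrite size_map size_tuple.
Qed.

Lemma rect_NNcoef (a : nat) : a <= M ->
  NNcoef lam mu (s_of lam - a) = chain_const M n * ('C(n + a, a) * (M - a)`!).
Proof.
move=> aM; rewrite /NNcoef /NNcoef_in -sum_chain // -sum_excited_rect //.
by rewrite subKn.
Qed.

(** * The rim of a rectangle as a ribbon *)

(** The rim follows the [M.+1] cells of the bottom row, then climbs the last column in [n.+1] steps,
    starting from cell number [M.+1]. *)
Definition rect_descents : {fset nat} := [fset i in iota M.+1 n.+1]%fset.

Lemma mem_rect_descents (i : nat) :
  (i \in rect_descents) = (M < i < M + n.+2).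
Proof.
have -> : (i \in rect_descents) = (i \in iota M.+1 n.+1) by exact: in_fset.
by rewrite mem_iota addSnnS.
Qed.

Definition rect_ribbon : seq (nat * nat) :=
  mkseq (fun k => if k <= M then (n.+1, k) else (n.+1 - (k - M), M)) (M + n.+2).

Lemma rect_is_lambdaI : is_lambdaI rect_descents lam.
Proof.
split; [exact: nseq_partition | by rewrite !nth_rect_lam |].
exists rect_ribbon; split.
- rewrite map_inj_in_uniq ?iota_uniq // => k l; rewrite !mem_iota.
  by case: (leqP k M); case: (leqP l M) => h1 h2 h3 h4 []; lia.
- move=> [i j]; rewrite /rim /= !in_diagE !nth_rect_lam !ltnS.
  apply/idP/mapP => [H|[k]].
    (* The position of [(i, j)] along the ribbon; the corner [(n.+1, M)] falls in the second case,
       at position [M]. *)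
    exists (if j < M then j else M + (n.+1 - i)).
      by rewrite mem_iota; move: H; case: (ltngtP i n.+1); case: (leqP i n); case: (ltnP j M); lia.
    move: H; case: (ltnP j M) => hj.
      by rewrite (ltnW hj); case: (ltngtP i n.+1) => [h|h|->] //; case: (leqP i n) => h2; lia.
    case: (leqP _ M) => h; case: (leqP i n) => h2; case: (leqP i n.+1) => h3 H;
      congr pair; lia.
  rewrite mem_iota => hk kE; have {kE} : (k <= M /\ (i = n.+1 /\ j = k)) \/
      (M < k /\ (i = n.+1 - (k - M) /\ j = M)).
    by move: kE; case: (leqP k M) => h [-> ->]; [left | right].
  by case: (ltngtP i n.+1); case: (leqP i n); lia.
- rewrite size_mkseq => k hk; rewrite !nth_mkseq ?(ltnW hk) //.
  by case: (leqP k M) => h1; case: (leqP k.+1 M) => h2; rewrite /= ?xpair_eqE /=; lia.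
- move=> i; rewrite mem_rect_descents size_mkseq.
  case: (posnP i) => [->|i0] /=; first by [].
  case: (ltnP i (M + n.+2)) => hi; last by lia.
  rewrite !nth_mkseq ?(leq_ltn_trans (leq_pred _) hi) //.
  by case: (leqP i.-1 M); case: (leqP i M) => /=; lia.
Qed.

Lemma rect_descent_set : descent_set rect_descents.
Proof.
split; last by move=> i; rewrite mem_rect_descents; lia.
by apply/fset0Pn; exists M.+1; rewrite mem_rect_descents; lia.
Qed.

End Rectangle.

Local Open Scope ring_scope.

(** * The sets of ratios *)

(** In the quotient of two values of [rect_NNcoef] the constant cancels, the binomials leave
    [(n.+1 + a) / a.+1] and the factorials [1 / (M - a)]. *)
Lemma Tset_rect (R : realType) (a n M : nat) : (a < M)%N ->
  Tset a ((n.+1 + a)%:R / (a.+1 * (M - a))%:R : R).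
Proof.
move=> aM; have M_gt0 : (0 < M)%N by apply: leq_ltn_trans aM.
exists (rect_descents n M), (nseq n.+2 M.+1), (nseq n.+1 M); split.
- exact: rect_descent_set.
- exact: rect_is_lambdaI.
- exact: rect_is_muI.
- exact: aM.
have -> : ((s_of (nseq n.+2 M.+1) - a).-1 = s_of (nseq n.+2 M.+1) - a.+1)%N.
  by rewrite subnS.
rewrite !rect_NNcoef //; last exact: ltnW.
have K0 := chain_const_gt0 M n.
have C0 : (0 < 'C(n + a, a))%N by rewrite bin_gt0 leq_addl.
have [d Md] : exists d, (M - a = d.+1)%N by exists (M - a.+1)%N; lia.
have Md' : (M - a.+1 = d)%N by lia.
rewrite Md Md'; split.
  by rewrite -lt0n !muln_gt0 K0 C0 fact_gt0.
have E : (a.+1 * 'C(n + a.+1, a.+1) = (n.+1 + a) * 'C(n + a, a))%N.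
  by rewrite addnS -mul_bin_diag addSn.
apply/eqP; rewrite eqr_div ?pnatr_eq0 -?lt0n ?muln_gt0 ?K0 ?C0 ?fact_gt0 //.
rewrite -!natrM eqr_nat factS; apply/eqP.
move: E; move: ('C(_, _)) ('C(_, _)) (chain_const _ _) (d`!) => X Y K F E.
transitivity ((K * F * d.+1) * (a.+1 * Y))%N; last by lia.
by rewrite E; lia.
Qed.

Lemma Tset_ratr (R : realType) (a : nat) (q : rat) :
  0 < q -> Tset a (ratr q : R).
Proof.
move=> q0.
have [u [v [u0 v0 ->]]] : exists u v : nat,
    [/\ (0 < u)%N, (0 < v)%N & q = u%:R / v%:R].
  exists `|numq q|%N, `|denq q|%N.
  rewrite !absz_gt0 numq_eq0 denq_neq0 gt_eqF //; split=> //.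
  by rewrite !natr_absz !gtr0_norm ?numq_gt0 // divq_num_den.
(* For [q = u / v] take [M = v + a] and [n = (a+1)u - a - 1], which is nonnegative as [u > 0]; the
   common factor [a.+1] cancels. *)
have -> : ratr (u%:R / v%:R) =
    ((a.+1 * u - a).-1.+1 + a)%:R / (a.+1 * (v + a - a))%:R :> R.
  have -> : ((a.+1 * u - a).-1.+1 + a = a.+1 * u)%N by nia.
  by rewrite addnK !natrM fmorph_div !rmorph_nat -mulf_div divff ?mul1r ?pnatr_eq0.
by apply: Tset_rect; lia.
Qed.

Lemma Tset_ge0 (R : realType) (a : nat) (x : R) : Tset a x -> 0 <= x.
Proof. by move=> [I [lam [mu [_ _ _ _ [_ ->]]]]]; rewrite divr_ge0. Qed.

Lemma Tset0_rat (R : realType) (x : R) :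
  Tset 0 x -> exists q : rat, 0 < q /\ x = ratr q.
Proof.
move=> [I [lam [mu [_ [lamP lam01 _] muI s0 [c0 ->]]]]].
have lam_mu := is_muI_inner lamP muI.
(* Only the corner cell stays in place. It belongs to mu because the first two rows of lambda have
   equal length, at least 2. *)
pose f i := (i == 0 : nat)%N.
have fP : unmoved_rows mu f.
  move=> [|i]; rewrite /f /=; last by lia.
  split=> //; case: lam_mu => _ _ ->; rewrite -lam01.
  by move: s0; rewrite /s_of; lia.
have := NNcoef_gt0 lam_mu fP s0; rewrite /f /= subn1 -(subn0 (s_of lam)).
rewrite subn0 => n0.
exists ((NNcoef lam mu (s_of lam).-1)%:R / (NNcoef lam mu (s_of lam - 0))%:R).
split; last by rewrite fmorph_div !rmorph_nat subn0.
by rewrite divr_gt0 ?ltr0n // lt0n.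
Qed.

Local Open Scope classical_set_scope.
Local Open Scope ring_scope.

Theorem theorem5p3 (R : realType) :
  (forall a : nat, closure (@Tset R a) = [set x : R | 0 <= x]) /\
  @Tset R 0 = [set x : R | exists q : rat, 0 < q /\ x = ratr q].
Proof.
split=> [a|]; last first.
  apply/seteqP; split=> x /=; first exact: Tset0_rat.
  by move=> [q [q0 ->]]; apply: Tset_ratr.
apply/seteqP; split=> x /=.
  have /closure_id cl_ge0 := @closed_ge R 0.
  suff : closure (@Tset R a) `<=` [set y | 0 <= y] by apply.
  by rewrite cl_ge0; apply: closureS => y; apply: Tset_ge0.
move=> x0 U /nbhs_ballP[e /= e0 xU].
(* The rational is taken strictly right of [x], so it is positive even when [x = 0]. *)
have /rat_in_itvoo[q /andP[]] : x < x + e by rewrite ltrDl.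
rewrite !bnd_simp => xq qe; exists (ratr q); split.
  by apply: Tset_ratr; rewrite -(ltr0q R); apply: le_lt_trans xq.
apply: xU; rewrite /ball /= ltr_distlC; lra.
Qed.
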